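(* Let $n$ be a positive integer with $n\equiv 0\pmod{12}$. Fix any Type III code $C$ of length $n$ containing the all-ones vector $\mathbf 1$ and, for $0\le k\le\frac n2-1$, let $L_k^{\mathrm{III}}(n,\mathbf 1)$ be the number of Type III codes of length $n$ that contain $\mathbf 1$ and are $k$-neighbors of $C$. Then the number of Type III codes of length $n$ containing $\mathbf 1$ is $$\sum_{k=0}^{\frac n2-1}L_k^{\mathrm{III}}(n,\mathbf 1).$$
   Context: Equip $\mathbb{F}_3^n$ with the inner product $u\cdot v=\sum_{i=1}^n u_iv_i$. A code of length $n$ over $\mathbb{F}_3$ is a linear subspace $C\subseteq\mathbb{F}_3^n$; its dual is $C^\perp=\{v\in\mathbb{F}_3^n : u\cdot v=0 \text{ for all } u\in C\}$, and $C$ is self-dual if $C=C^\perp$ (so $\dim C=n/2$). The weight of a vector is its number of nonzero coordinates. A Type III code is a self-dual code over $\mathbb{F}_3$ in which every codeword has weight divisible by $3$. $\mathbf 1=(1,\dots,1)$. Codes are counted as subspaces (not up to equivalence). For $0\le k\le n/2$, two self-dual codes $C,D$ of length $n$ are $k$-neighbors if $\dim(C\cap D)=\frac n2-k$ (in particular, the only $0$-neighbor of $C$ is $C$ itself). *)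

(* Defs.v *)
From HB Require Import structures.
From mathcomp Require Import all_boot all_order all_algebra.

Set Implicit Arguments.
Unset Strict Implicit.
Unset Printing Implicit Defensive.

Import GRing.Theory.

Local Open Scope ring_scope.

Definition ternary_code (n : nat) : Type := {vspace 'rV['F_3]_n}.

(* {vspace _} has no finType structure in the library; a code is recovered from
   its finite set of codewords, so codes can be counted as subspaces. *)
Definition codewords n (C : ternary_code n) : {set 'rV['F_3]_n} :=
  [set v | v \in C].

Lemma codewordsK n :
  cancel (@codewords n) (fun S : {set 'rV['F_3]_n} => <<enum S>>%VS).
Proof.
move=> C; apply/eqP; rewrite eqEsubv; apply/andP; split.
  by apply/span_subvP => v; rewrite mem_enum inE.
by apply/subvP => v Cv; apply: memv_span; rewrite mem_enum inE.
Qed.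

HB.instance Definition _ n :=
  Finite.copy (ternary_code n) (can_type (@codewordsK n)).

Definition dotp n (u v : 'rV['F_3]_n) : 'F_3 := \sum_(i < n) u 0 i * v 0 i.

Definition wt n (v : 'rV['F_3]_n) : nat := #|[set i : 'I_n | v 0 i != 0]|.

Definition dual_code n (C : ternary_code n) : {set 'rV['F_3]_n} :=
  [set v | [forall u in C, dotp u v == 0]].

Definition self_dual n (C : ternary_code n) : bool :=
  codewords C == dual_code C.

Definition type_III n (C : ternary_code n) : bool :=
  self_dual C && [forall v in C, (3 %| wt v)%N].

Definition all_ones n : 'rV['F_3]_n := const_mx 1.

(* The bound on k keeps the truncated subtraction n./2 - k exact. *)
Definition k_neighbors n (k : nat) (C D : ternary_code n) : bool :=
  [&& self_dual C, self_dual D, (k <= n./2)%N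
    & \dim (C :&: D)%VS == (n./2 - k)%N].

Definition L_III n (C : ternary_code n) (k : nat) : nat :=
  #|[set D : ternary_code n |
      [&& type_III D, all_ones n \in D & k_neighbors k C D]]|.

(* Main.v *)
Require Import Defs.
From mathcomp Require Import all_boot all_order all_algebra.

(** Every code [D] under count meets [C] in a subspace that contains the
nonzero vector [all_ones n], so [1 <= \dim (C :&: D)]; and self-orthogonality
of [C] forces [\dim (C :&: D) <= \dim C <= n./2].  Hence exactly one
[k < n./2] satisfies [\dim (C :&: D) = n./2 - k], and sorting the codes [D] by
this [k] splits the count into the numbers [L_III C k].  The only input beyond
this is [self_dual_dim_le], which comes from the rank inequality for a product
of matrices that vanishes. *)

Import GRing.Theory.

Local Open Scope ring_scope.

(** The rows of [M] are a basis of [C]; as they are pairwise orthogonal,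
[M *m M^T = 0], which bounds [\rank M + \rank M^T = (\dim C).*2] by [n]. *)
Lemma self_dual_dim_le n (C : ternary_code n) :
  self_dual C -> (\dim C <= n./2)%N.
Proof.
move=> /eqP dualC.
pose M := \matrix_(i < \dim C) (vbasis C)`_i.
have rankM : \rank M = \dim C.
  apply/eqP/inj_row_free => v; rewrite mulmx_sum_row => vM0.
  apply/rowP => i; rewrite mxE.
  move/freeP: (basis_free (vbasisP C)); apply.
  by rewrite -[RHS]vM0; apply: eq_bigr => j _; rewrite rowK.
have MMt0 : M *m M^T = 0.
  apply/matrixP => i j; rewrite !mxE.
  have memC (k : 'I_(\dim C)) : (vbasis C)`_k \in C.
    by rewrite vbasis_mem // mem_nth // size_tuple.
  have : (vbasis C)`_j \in codewords C by rewrite inE memC.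
  rewrite dualC inE => /forall_inP/(_ _ (memC i))/eqP {2}<-.
  by apply: eq_bigr => k _; rewrite !mxE.
by have := mulmx0_rank_max MMt0; rewrite mxrank_tr rankM addnn geq_half_double.
Qed.

Lemma all_ones_neq0 n : (0 < n)%N -> all_ones n != 0.
Proof.
case: n => // n _; apply/eqP => /rowP/(_ ord0).
by rewrite !mxE => /eqP; rewrite oner_eq0.
Qed.

Lemma dim_gt0 (K : fieldType) (V : vectType K) (U : {vspace V}) (v : V) :
  v \in U -> v != 0 -> (0 < \dim U)%N.
Proof.
by move=> Uv; apply: contraR; rewrite lt0n negbK dimv_eq0 -memv0 => /eqP <-.
Qed.

Local Close Scope ring_scope.

Theorem theorem4p15 (n : nat) (n_gt0 : 0 < n) (n_mod12 : n = 0 %[mod 12])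
    (C : ternary_code n) (C_III : type_III C) (C_ones : all_ones n \in C) :
  #|[set D : ternary_code n | type_III D && (all_ones n \in D)]|
    = \sum_(0 <= k < n./2) L_III C k.
Proof.
have [sdC _] := andP C_III.
have dimC := self_dual_dim_le _ _ sdC.
have ones0 := all_ones_neq0 _ n_gt0.
have half_gt0 : 0 < n./2 by apply: leq_trans dimC; apply: dim_gt0 C_ones ones0.
have dim_le D : \dim (C :&: D)%VS <= n./2.
  by apply: leq_trans dimC; rewrite dimvS ?capvSl.
have dim_pos (D : ternary_code n) :
    all_ones n \in D -> 0 < \dim (C :&: D)%VS.
  by move=> D1; apply: dim_gt0 ones0; rewrite memv_cap C_ones.
(* when [all_ones n \in D] the dimension is positive, so the default is not taken *)
pose codim (D : ternary_code n) : 'I_n./2 :=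
  insubd (Ordinal half_gt0) (n./2 - \dim (C :&: D)%VS).
rewrite big_mkord -sum1_card (partition_big codim xpredT) //=.
apply: eq_bigr => k _; rewrite /L_III -sum1_card; apply: eq_bigl => D.
rewrite !inE -andbA; case D_III: (type_III D) => //=.
case D1: (all_ones n \in D) => //=.
have [sdD _] := andP D_III.
rewrite /k_neighbors sdC sdD (ltnW (ltn_ord k)) /= -val_eqE val_insubd.
rewrite ltn_subrL dim_pos // half_gt0 /=.
(* both sides say that [k] and the dimension add up to [n./2] *)
by rewrite -(eqn_add2r (\dim (C :&: D)%VS)) subnK // eq_sym
           -[RHS](eqn_add2l k) subnKC // ltnW.
Qed.
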